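(* Let $U$ be the forgetful functor from the category $(1,\infty)\text{-}\mathbb{C}\mathbb{E}\mathrm{tC}$ of cubical $(1,\infty)$-categorical stretchings to $(\mathbb{C}\mathrm{Sets})^4$, sending $(\tau_M,\tau_C)$ to the quadruple $(M_{0,0},M_{1,0},M_{0,1},M_{1,1})$ of underlying cubical sets of its magmas. Then $U$ has a left adjoint, and hence the adjunction produces a monad $\mathbb{T}^1=(T^1,\lambda^1,\mu^1)$ on $(\mathbb{C}\mathrm{Sets})^4$.
   Context: **Cubical sets.** A cubical set is a family of sets $(C_n)_{n\ge 0}$ with maps (sources and targets) $s^n_{n-1,j},t^n_{n-1,j}:C_n\to C_{n-1}$ for $n\ge1$, $1\le j\le n$, such that for $1\le i<j\le n$: $s^{n-1}_{n-2,i}s^n_{n-1,j}=s^{n-1}_{n-2,j-1}s^n_{n-1,i}$; $s^{n-1}_{n-2,i}t^n_{n-1,j}=t^{n-1}_{n-2,j-1}s^n_{n-1,i}$; $t^{n-1}_{n-2,i}s^n_{n-1,j}=s^{n-1}_{n-2,j-1}t^n_{n-1,i}$; $t^{n-1}_{n-2,i}t^n_{n-1,j}=t^{n-1}_{n-2,j-1}t^n_{n-1,i}$. Morphisms are families of maps commuting with all sources and targets. The category is $\mathbb{C}\mathrm{Sets}$; $s^1_0,t^1_0$ denote $s^1_{0,1},t^1_{0,1}$. **Reflexive cubical sets.** A reflexive cubical set is a cubical set with maps $1^{n}_{n+1,j}:C_n\to C_{n+1}$ ($n\ge0$, $1\le j\le n+1$; classical reflexions) and $1^{n,\gamma}_{n+1,j}:C_n\to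 C_{n+1}$ ($n\ge1$, $1\le j\le n$, $\gamma\in\{+,-\}$; connections) such that, whenever the maps are defined (and with $r$ denoting either $s$ everywhere or $t$ everywhere): - $1^n_{n+1,i}1^{n-1}_{n,j}=1^n_{n+1,j+1}1^{n-1}_{n,i}$ for $1\le i\le j\le n$; - $r^n_{n-1,i}1^{n-1}_{n,j}=1^{n-2}_{n-1,j-1}r^{n-1}_{n-2,i}$ for $1\le i<j\le n$; $=1^{n-2}_{n-1,j}r^{n-1}_{n-2,i-1}$ for $1\le j<i\le n$; $=\mathrm{id}$ for $i=j$; - $1^{n,\gamma}_{n+1,i}1^{n-1,\gamma}_{n,j}=1^{n,\gamma}_{n+1,j+1}1^{n-1,\gamma}_{n,i}$ for $1\le i<j\le n-1$, and $1^{n,\gamma}_{n+1,i}1^{n-1,\gamma}_{n,i}=1^{n,\gamma}_{n+1,i+1}1^{n-1,\gamma}_{n,i}$ for $1\le i\le n-1$; - $1^{n,\gamma}_{n+1,i}1^{n-1}_{n,j}=1^n_{n+1,j+1}1^{n-1,\gamma}_{n,i}$ for $1\le i<j\le n$; $=1^n_{n+1,j}1^{n-1,\gamma}_{n,i-1}$ for $1\le j<i\le n$; and $1^{n,\gamma}_{n+1,j}1^{n-1}_{n,j}=1^n_{n+1,j}1^{n-1}_{n,j}$ for $1\le j\le n$; - $r^n_{n-1,i}1^{n-1,\gamma}_{n,j}=1^{n-2,\gamma}_{n-1,j-1}r^{n-1}_{n-2,i}$ for $1\le i<j\le n-1$; $=1^{n-2,\gamma}_{n-1,j}r^{n-1}_{n-2,i-1}$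 for $2\le j+1<i\le n$; - for $1\le j\le n-1$: $s^n_{n-1,j}1^{n-1,-}_{n,j}=s^n_{n-1,j+1}1^{n-1,-}_{n,j}=\mathrm{id}$, $t^n_{n-1,j}1^{n-1,+}_{n,j}=t^n_{n-1,j+1}1^{n-1,+}_{n,j}=\mathrm{id}$, $s^n_{n-1,j}1^{n-1,+}_{n,j}=s^n_{n-1,j+1}1^{n-1,+}_{n,j}=1^{n-2}_{n-1,j}s^{n-1}_{n-2,j}$, $t^n_{n-1,j}1^{n-1,-}_{n,j}=t^n_{n-1,j+1}1^{n-1,-}_{n,j}=1^{n-2}_{n-1,j}t^{n-1}_{n-2,j}$. **Cubical reflexive $\infty$-magmas.** A reflexive cubical set with partial operations $\circ^n_j$ on $C_n$ ($n\ge1$, $1\le j\le n$), where $a\circ^n_jb$ is defined exactly when $t^n_{n-1,j}(a)=s^n_{n-1,j}(b)$, such that $s^n_{n-1,j}(a\circ^n_jb)=s^n_{n-1,j}(a)$, $t^n_{n-1,j}(a\circ^n_jb)=t^n_{n-1,j}(b)$, and for $r\in\{s,t\}$: $r^n_{n-1,i}(a\circ^n_jb)=r^n_{n-1,i}(a)\circ^{n-1}_{j-1}r^n_{n-1,i}(b)$ if $i<j$, and $=r^n_{n-1,i}(a)\circ^{n-1}_{j}r^n_{n-1,i}(b)$ if $j<i$. Morphisms are maps commuting with sources, targets, reflexions, connections and the operations $\circ^n_j$. The category is $\infty\text{-}\mathbb{C}\mathbb{M}\mathrm{ag}_r$. **Strict cubical $\infty$-categories.** A strict cubical $\infty$-category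 is a cubical reflexive $\infty$-magma such that the operations are associative and unital ($1^{n-1}_{n,j}(s^n_{n-1,j}(a))\circ^n_ja=a=a\circ^n_j1^{n-1}_{n,j}(t^n_{n-1,j}(a))$), and such that: - interchange: $(a\circ^n_ib)\circ^n_j(c\circ^n_id)=(a\circ^n_jc)\circ^n_i(b\circ^n_jd)$ for $i\ne j$ whenever both sides are defined; - $1^n_{n+1,i}(a\circ^n_jb)=1^n_{n+1,i}(a)\circ^{n+1}_{j+1}1^n_{n+1,i}(b)$ if $1\le i\le j\le n$, and $=1^n_{n+1,i}(a)\circ^{n+1}_j1^n_{n+1,i}(b)$ if $1\le j<i\le n+1$; - $1^{n,\gamma}_{n+1,i}(a\circ^n_jb)=1^{n,\gamma}_{n+1,i}(a)\circ^{n+1}_{j+1}1^{n,\gamma}_{n+1,i}(b)$ if $1\le i<j\le n$, and $=1^{n,\gamma}_{n+1,i}(a)\circ^{n+1}_j1^{n,\gamma}_{n+1,i}(b)$ if $1\le j<i\le n$; - transport laws, for $1\le j\le n$: $1^{n,+}_{n+1,j}(a\circ^n_jb)=\bigl(1^{n,+}_{n+1,j}(a)\circ^{n+1}_j1^n_{n+1,j}(a)\bigr)\circ^{n+1}_{j+1}\bigl(1^n_{n+1,j+1}(a)\circ^{n+1}_j1^{n,+}_{n+1,j}(b)\bigr)$ and $1^{n,-}_{n+1,j}(a\circ^n_jb)=\bigl(1^{n,-}_{n+1,j}(a)\circ^{n+1}_j1^n_{n+1,j+1}(b)\bigr)\circ^{n+1}_{j+1}\bigl(1^n_{n+1,j}(b)\circ^{n+1}_j1^{n,-}_{n+1,j}(b)\bigr)$;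 - for $1\le i\le n$: $1^{n,+}_{n+1,i}(x)\circ^{n+1}_i1^{n,-}_{n+1,i}(x)=1^n_{n+1,i+1}(x)$ and $1^{n,+}_{n+1,i}(x)\circ^{n+1}_{i+1}1^{n,-}_{n+1,i}(x)=1^n_{n+1,i}(x)$. Strict cubical $\infty$-functors are the morphisms of cubical reflexive $\infty$-magmas between strict cubical $\infty$-categories. **Cubical categorical stretchings.** An object of $\infty\text{-}\mathbb{C}\mathbb{E}\mathrm{tC}$ is a quintuple $(M,C,\pi,([-;-]^n_{n+1,j})_{n\ge0,1\le j\le n+1},([-;-]^{n,\gamma}_{n+1,j})_{n\ge1,1\le j\le n,\gamma\in\{-,+\}})$ with $M$ a cubical reflexive $\infty$-magma, $C$ a strict cubical $\infty$-category, $\pi:M\to C$ a morphism of $\infty\text{-}\mathbb{C}\mathbb{M}\mathrm{ag}_r$, and bracketing maps as follows. Put $\underline{M}_0=\{(\alpha,\beta)\in M_0\times M_0:\alpha=\beta\}$ and for $n\ge1$, $\underline{M}_n=\{(\alpha,\beta)\in M_n\times M_n:\pi_n(\alpha)=\pi_n(\beta)\}$, $\underline{M}^s_{n,j}=\{(\alpha,\beta)\in\underline{M}_n:s^n_{n-1,j}(\alpha)=s^n_{n-1,j}(\beta)\}$, $\underline{M}^t_{n,j}=\{(\alpha,\beta)\in\underline{M}_n:t^n_{n-1,j}(\alpha)=t^n_{n-1,j}(\beta)\}$. The brackets are maps $[-;-]^n_{n+1,j}:\underline{M}_n\to M_{n+1}$, $[-;-]^{n,-}_{n+1,j}:\underline{M}^s_{n,j}\to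 M_{n+1}$, $[-;-]^{n,+}_{n+1,j}:\underline{M}^t_{n,j}\to M_{n+1}$ satisfying (each equation includes the requirement that the brackets in it be defined; $r\in\{s,t\}$): - $r^{n+1}_{n,i}([\alpha;\beta]^n_{n+1,j})=[r^n_{n-1,i}(\alpha);r^n_{n-1,i}(\beta)]^{n-1}_{n,j-1}$ if $1\le i<j\le n+1$; $=[r^n_{n-1,i-1}(\alpha);r^n_{n-1,i-1}(\beta)]^{n-1}_{n,j}$ if $1\le j<i\le n+1$; $s^{n+1}_{n,j}([\alpha;\beta]^n_{n+1,j})=\alpha$ and $t^{n+1}_{n,j}([\alpha;\beta]^n_{n+1,j})=\beta$; - $\pi_{n+1}([\alpha;\beta]^n_{n+1,j})=1^n_{n+1,j}(\pi_n(\alpha))=1^n_{n+1,j}(\pi_n(\beta))$, and $[\alpha;\alpha]^n_{n+1,j}=1^n_{n+1,j}(\alpha)$ for all $\alpha\in M_n$; - for $1\le j\le n$: $s^{n+1}_{n,j}([\alpha;\beta]^{n,-}_{n+1,j})=\alpha$, $s^{n+1}_{n,j+1}([\alpha;\beta]^{n,-}_{n+1,j})=\beta$, $t^{n+1}_{n,j}([\alpha;\beta]^{n,+}_{n+1,j})=\alpha$, $t^{n+1}_{n,j+1}([\alpha;\beta]^{n,+}_{n+1,j})=\beta$, $s^{n+1}_{n,j}([\alpha;\beta]^{n,+}_{n+1,j})=s^{n+1}_{n,j+1}([\alpha;\beta]^{n,+}_{n+1,j})=[s^n_{n-1,j}(\alpha);s^n_{n-1,j}(\beta)]^{n-1}_{n,j}$,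 $t^{n+1}_{n,j}([\alpha;\beta]^{n,-}_{n+1,j})=t^{n+1}_{n,j+1}([\alpha;\beta]^{n,-}_{n+1,j})=[t^n_{n-1,j}(\alpha);t^n_{n-1,j}(\beta)]^{n-1}_{n,j}$; - $r^{n+1}_{n,i}([\alpha;\beta]^{n,\gamma}_{n+1,j})=[r^n_{n-1,i}(\alpha);r^n_{n-1,i}(\beta)]^{n-1,\gamma}_{n,j-1}$ if $1\le i<j\le n$; $=[r^n_{n-1,i-1}(\alpha);r^n_{n-1,i-1}(\beta)]^{n-1,\gamma}_{n,j}$ if $2\le j+1<i\le n+1$; - $\pi_{n+1}([\alpha;\beta]^{n,\gamma}_{n+1,j})=1^{n,\gamma}_{n+1,j}(\pi_n(\alpha))=1^{n,\gamma}_{n+1,j}(\pi_n(\beta))$, and $[\alpha;\alpha]^{n,\gamma}_{n+1,j}=1^{n,\gamma}_{n+1,j}(\alpha)$ for all $\alpha\in M_n$. A morphism from $(M,C,\pi,\dots)$ to $(M',C',\pi',\dots)$ is a pair $(m,c)$ of morphisms $m:M\to M'$, $c:C\to C'$ of $\infty\text{-}\mathbb{C}\mathbb{M}\mathrm{ag}_r$ with $\pi'm=c\pi$, such that $m$ preserves all brackets: $m_{n+1}([\alpha;\beta]^n_{n+1,j})=[m_n(\alpha);m_n(\beta)]^n_{n+1,j}$ and $m_{n+1}([\alpha;\beta]^{n,\gamma}_{n+1,j})=[m_n(\alpha);m_n(\beta)]^{n,\gamma}_{n+1,j}$. **Cubical strict $\infty$-natural transformations.** An object $\tau$ of $(1,\infty)\text{-}\mathbb{C}\mathbb{T}\mathrm{rans}$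 consists of strict cubical $\infty$-categories $C_{0,0},C_{1,0},C_{0,1},C_{1,1}$, strict cubical $\infty$-functors $F:C_{0,0}\to C_{1,0}$, $G:C_{1,0}\to C_{1,1}$, $H:C_{0,0}\to C_{0,1}$, $K:C_{0,1}\to C_{1,1}$, and for each $0$-cell $a$ of $C_{0,0}$ a $1$-cell $\tau(a):G(F(a))\to K(H(a))$ of $C_{1,1}$ (i.e. with that source $s^1_0$ and target $t^1_0$) such that $G(F(f))\circ^1_1\tau(b)=\tau(a)\circ^1_1K(H(f))$ for every $1$-cell $f:a\to b$ of $C_{0,0}$. A morphism $\tau\to\tau'$ is a quadruple of strict cubical $\infty$-functors $c_{i,j}:C_{i,j}\to C'_{i,j}$ with $c_{1,0}F=F'c_{0,0}$, $c_{1,1}G=G'c_{1,0}$, $c_{0,1}H=H'c_{0,0}$, $c_{1,1}K=K'c_{0,1}$, and $c_{1,1}(\tau(a))=\tau'(c_{0,0}(a))$ for all $0$-cells $a$. **Cubical $(1,\infty)$-magmas.** An object $\tau_M$ consists of cubical reflexive $\infty$-magmas $M_{0,0},M_{1,0},M_{0,1},M_{1,1}$, morphisms of cubical sets (not required to preserve further structure) $F_M:M_{0,0}\to M_{1,0}$, $G_M:M_{1,0}\to M_{1,1}$, $H_M:M_{0,0}\to M_{0,1}$, $K_M:M_{0,1}\to M_{1,1}$, and a map $\tau_M:M_{0,0}(0)\to M_{1,1}(1)$ from $0$-cells to $1$-cells with $s^1_0(\tau_M(a))=G_M(F_M(a))$ and $t^1_0(\tau_M(a))=K_M(H_M(a))$.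 A morphism $\tau_M\to\tau'_M$ is a quadruple of morphisms $m_{i,j}:M_{i,j}\to M'_{i,j}$ of $\infty\text{-}\mathbb{C}\mathbb{M}\mathrm{ag}_r$ commuting with $F,G,H,K$ ($m_{1,0}F_M=F_M'm_{0,0}$, $m_{1,1}G_M=G_M'm_{1,0}$, $m_{0,1}H_M=H_M'm_{0,0}$, $m_{1,1}K_M=K_M'm_{0,1}$) and satisfying $m_{1,1}\circ\tau_M=\tau'_M\circ m_{0,0}$. **Cubical $(1,\infty)$-categorical stretchings.** An object $(\tau_M,\tau_C)$ of $(1,\infty)\text{-}\mathbb{C}\mathbb{E}\mathrm{tC}$ consists of four cubical categorical stretchings $\mathbb{E}_{i,j}=(M_{i,j},C_{i,j},\pi_{i,j},\text{brackets})$, $i,j\in\{0,1\}$, a cubical $(1,\infty)$-magma $\tau_M$ on the $M_{i,j}$ (with $F_M,G_M,H_M,K_M$) and a cubical strict $\infty$-natural transformation $\tau_C$ on the $C_{i,j}$ (with $F_C,G_C,H_C,K_C$) such that, in $\mathbb{C}\mathrm{Sets}$, $\pi_{1,0}F_M=F_C\pi_{0,0}$, $\pi_{1,1}G_M=G_C\pi_{1,0}$, $\pi_{0,1}H_M=H_C\pi_{0,0}$, $\pi_{1,1}K_M=K_C\pi_{0,1}$, and $\pi_{1,1}\circ\tau_M=\tau_C\circ\pi_{0,0}$. A morphism $(\tau_M,\tau_C)\to(\tau_M',\tau_C')$ is given by morphisms $(m_{i,j},c_{i,j}):\mathbb{E}_{i,j}\to\mathbb{E}'_{i,j}$ of cubical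 categorical stretchings such that $(m_{i,j})$ is a morphism $\tau_M\to\tau_M'$ of cubical $(1,\infty)$-magmas and $(c_{i,j})$ is a morphism $\tau_C\to\tau_C'$ of $(1,\infty)\text{-}\mathbb{C}\mathbb{T}\mathrm{rans}$. *)

(* Defs.v *)
From mathcomp Require Import all_boot.
From mathcomp Require Import boolp.

Set Implicit Arguments.
Unset Strict Implicit.
Unset Printing Implicit Defensive.

Local Obligation Tactic := idtac.

Record category := Category {
  ob :> Type;
  hom : ob -> ob -> Type;
  idc : forall X, hom X X;
  compc : forall X Y Z, hom Y Z -> hom X Y -> hom X Z;
  compc_idl : forall X Y (f : hom X Y), compc (idc Y) f = f;
  compc_idr : forall X Y (f : hom X Y), compc f (idc X) = f;
  compcA : forall X Y Z W (f : hom X Y) (g : hom Y Z) (h : hom Z W),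
    compc h (compc g f) = compc (compc h g) f }.
Arguments hom {c} X Y.
Arguments idc {c} X.
Arguments compc {c X Y Z} g f.

Declare Scope cat_scope.
Delimit Scope cat_scope with cat.
Local Open Scope cat_scope.
Notation "g \oc f" := (compc g f)
  (at level 50, left associativity) : cat_scope.

Record functor (C D : category) := Functor {
  fob :> C -> D;
  fmap : forall X Y : C, hom X Y -> hom (fob X) (fob Y);
  fmap_id : forall X : C, fmap (idc X) = idc (fob X);
  fmap_comp : forall (X Y Z : C) (g : hom Y Z) (f : hom X Y),
    fmap (g \oc f) = fmap g \oc fmap f }.
Arguments fmap {C D} F {X Y} f : rename.

Definition id_functor (C : category) : functor C C :=
  @Functor C C (fun X => X) (fun X Y f => f)
    (fun X => erefl) (fun X Y Z g f => erefl).

Program Definition comp_functor (C D E : category)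
    (G : functor D E) (F : functor C D) : functor C E :=
  @Functor C E (fun X => G (F X)) (fun X Y f => fmap G (fmap F f)) _ _.
Next Obligation. by move=> C D E G F X /=; rewrite !fmap_id. Qed.
Next Obligation. by move=> C D E G F X Y Z g f /=; rewrite !fmap_comp. Qed.

Notation "G \of F" := (comp_functor G F)
  (at level 50, left associativity) : cat_scope.

Record nattrans (C D : category) (F G : functor C D) := NatTrans {
  component :> forall X : C, hom (F X) (G X);
  naturality : forall (X Y : C) (f : hom X Y),
    component Y \oc fmap F f = fmap G f \oc component X }.

Record adjunction (C D : category) (L : functor C D) (R : functor D C) :=
  Adjunction {
  adj_unit : nattrans (id_functor C) (R \of L);
  adj_counit : nattrans (L \of R) (id_functor D);
  adj_triangleL : forall X : C,
    adj_counit (L X) \oc fmap L (adj_unit X) = idc (L X);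
  adj_triangleR : forall Y : D,
    fmap R (adj_counit Y) \oc adj_unit (R Y) = idc (R Y) }.

Record is_monad (C : category) (T : functor C C)
    (eta : nattrans (id_functor C) T) (mu : nattrans (T \of T) T) : Prop :=
  IsMonad {
  monad_unitl : forall X : C, mu X \oc eta (T X) = idc (T X);
  monad_unitr : forall X : C, mu X \oc fmap T (eta X) = idc (T X);
  monad_assoc : forall X : C, mu X \oc mu (T X) = mu X \oc fmap T (mu X) }.

(* The natural transformation [R eps L : R L R L -> R L]. *)
Program Definition adj_mult (C D : category) (L : functor C D)
    (R : functor D C) (A : adjunction L R) :
    nattrans ((R \of L) \of (R \of L)) (R \of L) :=
  @NatTrans _ _ _ _ (fun X => fmap R (adj_counit A (L X))) _.
Next Obligation.
move=> C D L R A X Y f /=; rewrite -!fmap_comp.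
by have /= -> := naturality (adj_counit A) (fmap L f).
Qed.

Program Definition power_category (I : Type) (C : category) : category :=
  @Category (I -> C) (fun X Y => forall i, hom (X i) (Y i))
    (fun X i => idc (X i)) (fun X Y Z g f i => g i \oc f i) _ _ _.
Next Obligation.
by move=> I C X Y f; apply: functional_extensionality_dep => i; exact: compc_idl.
Qed.
Next Obligation.
by move=> I C X Y f; apply: functional_extensionality_dep => i; exact: compc_idr.
Qed.
Next Obligation.
by move=> I C X Y Z W f g h; apply: functional_extensionality_dep => i; exact: compcA.
Qed.

(* Directions are numbered from 0: a direction 1 <= j <= n is the element     *)
(* j - 1 of 'I_n.  The two maps ['I_n -> 'I_n.+1] below respectively keep the *)
(* value of an index and add 1 to it, so that an equation about directions    *)
(* i < j is stated with [lo i] and [up j] for i <= j, and then the direction  *)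
(* "j - 1" is [j].                                                            *)
(*                                                                            *)
(* Operations that only exist in dimension n >= 1 are stated in dimension     *)
(* n.+1.                                                                      *)
(*                                                                            *)
(* Signs are booleans: [false] stands for - and for sources, [true] for +     *)
(* and for targets.                                                           *)
(*                                                                            *)
(* A partial operation takes a proof that its arguments are in its domain; by *)
(* [Prop_irrelevance] its value does not depend on that proof.  Equations     *)
(* between partial operations are quantified over all such proofs, i.e. they  *)
(* hold whenever both sides are defined; when an equation also asserts that   *)
(* its right-hand side is defined, the proof is existentially quantified.     *)

Definition lo n (i : 'I_n) : 'I_n.+1 := widen_ord (leqnSn n) i.
Definition up n (i : 'I_n) : 'I_n.+1 := lift ord0 i.

Record cset := CSet {
  cell :> nat -> Type;
  face : forall (r : bool) {n : nat}, 'I_n.+1 -> cell n.+1 -> cell n;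
  face_face : forall r r' n (i j : 'I_n.+1) (x : cell n.+2), i <= j ->
    face r i (face r' (up j) x) = face r' j (face r (lo i) x) }.
Arguments face {c} r {n} j x : rename.

Notation src := (face false).
Notation tgt := (face true).

Record cset_hom (C D : cset) := CSetHom {
  cfun :> forall n, C n -> D n;
  cfun_face : forall r n (j : 'I_n.+1) (x : C n.+1),
    cfun (face r j x) = face r j (cfun x) }.
Arguments cfun {C D} f {n} x : rename.

Record rcset := RCSet {
  rcset_cset :> cset;
  degen : forall {n : nat}, 'I_n.+1 -> rcset_cset n -> rcset_cset n.+1;
  conn : forall (g : bool) {n : nat},
    'I_n.+1 -> rcset_cset n.+1 -> rcset_cset n.+2;
  degen_degen : forall n (i j : 'I_n.+1) (x : rcset_cset n), i <= j ->
    degen (lo i) (degen j x) = degen (up j) (degen i x);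
  face_degen_lt : forall r n (i j : 'I_n.+1) (x : rcset_cset n.+1), i <= j ->
    face r (lo i) (degen (up j) x) = degen j (face r i x);
  face_degen_gt : forall r n (i j : 'I_n.+1) (x : rcset_cset n.+1), j <= i ->
    face r (up i) (degen (lo j) x) = degen j (face r i x);
  face_degen_eq : forall r n (i : 'I_n.+1) (x : rcset_cset n),
    face r i (degen i x) = x;
  conn_conn : forall g n (i j : 'I_n.+1) (x : rcset_cset n.+1), i <= j ->
    conn g (lo i) (conn g j x) = conn g (up j) (conn g i x);
  conn_degen_lt : forall g n (i j : 'I_n.+1) (x : rcset_cset n.+1), i <= j ->
    conn g (lo i) (degen (up j) x) = degen (up (up j)) (conn g i x);
  conn_degen_gt : forall g n (i j : 'I_n.+1) (x : rcset_cset n.+1), j <= i ->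
    conn g (up i) (degen (lo j) x) = degen (lo (lo j)) (conn g i x);
  conn_degen_eq : forall g n (j : 'I_n.+1) (x : rcset_cset n),
    conn g j (degen j x) = degen (lo j) (degen j x);
  face_conn_lt : forall r g n (i j : 'I_n.+1) (x : rcset_cset n.+2), i <= j ->
    face r (lo (lo i)) (conn g (up j) x) = conn g j (face r (lo i) x);
  face_conn_gt : forall r g n (i j : 'I_n.+1) (x : rcset_cset n.+2), j <= i ->
    face r (up (up i)) (conn g (lo j) x) = conn g j (face r (up i) x);
  face_conn_same_lo : forall g n (j : 'I_n.+1) (x : rcset_cset n.+1),
    face g (lo j) (conn g j x) = x;
  face_conn_same_up : forall g n (j : 'I_n.+1) (x : rcset_cset n.+1),
    face g (up j) (conn g j x) = x;
  face_conn_opp_lo : forall g n (j : 'I_n.+1) (x : rcset_cset n.+1),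
    face (~~ g) (lo j) (conn g j x) = degen j (face (~~ g) j x);
  face_conn_opp_up : forall g n (j : 'I_n.+1) (x : rcset_cset n.+1),
    face (~~ g) (up j) (conn g j x) = degen j (face (~~ g) j x) }.
Arguments degen {r n} j x : rename.
Arguments conn {r} g {n} j x : rename.

Record magma := Magma {
  magma_rcset :> rcset;
  circ : forall {n : nat} (j : 'I_n.+1) (a b : magma_rcset n.+1),
    tgt j a = src j b -> magma_rcset n.+1;
  src_circ : forall n (j : 'I_n.+1) (a b : magma_rcset n.+1) h,
    src j (@circ _ j a b h) = src j a;
  tgt_circ : forall n (j : 'I_n.+1) (a b : magma_rcset n.+1) h,
    tgt j (@circ _ j a b h) = tgt j b;
  face_circ_lt : forall r n (i j : 'I_n.+1) (a b : magma_rcset n.+2) h h',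
    i <= j ->
    face r (lo i) (@circ _ (up j) a b h)
    = @circ _ j (face r (lo i) a) (face r (lo i) b) h';
  face_circ_gt : forall r n (i j : 'I_n.+1) (a b : magma_rcset n.+2) h h',
    j <= i ->
    face r (up i) (@circ _ (lo j) a b h)
    = @circ _ j (face r (up i) a) (face r (up i) b) h' }.
Arguments circ {m n} j a b h : rename.

Record magma_hom (M N : magma) := MagmaHom {
  magma_hom_cset :> cset_hom M N;
  mfun_degen : forall n (j : 'I_n.+1) (x : M n),
    magma_hom_cset _ (degen j x) = degen j (magma_hom_cset _ x);
  mfun_conn : forall g n (j : 'I_n.+1) (x : M n.+1),
    magma_hom_cset _ (conn g j x) = conn g j (magma_hom_cset _ x);
  mfun_circ : forall n (j : 'I_n.+1) (a b : M n.+1) h h',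
    magma_hom_cset _ (circ j a b h)
    = circ j (magma_hom_cset _ a) (magma_hom_cset _ b) h' }.

Record is_strict (C : magma) : Prop := IsStrict {
  circ_assoc : forall n (j : 'I_n.+1) (a b c : C n.+1) hab hbc h h',
    circ j (circ j a b hab) c h = circ j a (circ j b c hbc) h';
  circ_unitl : forall n (j : 'I_n.+1) (a : C n.+1) h,
    circ j (degen j (src j a)) a h = a;
  circ_unitr : forall n (j : 'I_n.+1) (a : C n.+1) h,
    circ j a (degen j (tgt j a)) h = a;
  circ_interchange : forall n (i j : 'I_n.+1) (a b c d : C n.+1)
      hab hcd hac hbd h h', i != j ->
    circ j (circ i a b hab) (circ i c d hcd) h
    = circ i (circ j a c hac) (circ j b d hbd) h';
  degen_circ_le : forall n (i j : 'I_n.+1) (a b : C n.+1) h h', i <= j ->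
    degen (lo i) (circ j a b h)
    = circ (up j) (degen (lo i) a) (degen (lo i) b) h';
  degen_circ_gt : forall n (i j : 'I_n.+1) (a b : C n.+1) h h', j <= i ->
    degen (up i) (circ j a b h)
    = circ (lo j) (degen (up i) a) (degen (up i) b) h';
  conn_circ_lt : forall g n (i j : 'I_n.+1) (a b : C n.+1) h h', i < j ->
    conn g i (circ j a b h) = circ (up j) (conn g i a) (conn g i b) h';
  conn_circ_gt : forall g n (i j : 'I_n.+1) (a b : C n.+1) h h', j < i ->
    conn g i (circ j a b h) = circ (lo j) (conn g i a) (conn g i b) h';
  transport_plus : forall n (j : 'I_n.+1) (a b : C n.+1) h h1 h2 h',
    conn true j (circ j a b h)
    = circ (up j) (circ (lo j) (conn true j a) (degen (lo j) a) h1)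
                  (circ (lo j) (degen (up j) a) (conn true j b) h2) h';
  transport_minus : forall n (j : 'I_n.+1) (a b : C n.+1) h h1 h2 h',
    conn false j (circ j a b h)
    = circ (up j) (circ (lo j) (conn false j a) (degen (up j) b) h1)
                  (circ (lo j) (degen (lo j) b) (conn false j b) h2) h';
  conn_cancel_lo : forall n (i : 'I_n.+1) (x : C n.+1) h,
    circ (lo i) (conn true i x) (conn false i x) h = degen (up i) x;
  conn_cancel_up : forall n (i : 'I_n.+1) (x : C n.+1) h,
    circ (up i) (conn true i x) (conn false i x) h = degen (lo i) x }.

Record strict_cat := StrictCat {
  strict_magma :> magma;
  strict_laws : is_strict strict_magma }.

(* Domain of the brackets [-;-]^n_{n+1,j}. *)
Definition brdom (M C : cset) (p : cset_hom M C) n : M n -> M n -> Prop :=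
  match n with
  | 0 => fun a b => a = b
  | _.+1 => fun a b => p _ a = p _ b
  end.
Arguments brdom {M C} p {n} a b : rename.

(* Domain of the brackets [-;-]^{n,g}_{n+1,j}: [face g] is a source for -, a
   target for +. *)
Definition cbrdom (M C : cset) (p : cset_hom M C) (g : bool) n
    (j : 'I_n.+1) (a b : M n.+1) : Prop :=
  p _ a = p _ b /\ face g j a = face g j b.
Arguments cbrdom {M C} p g {n} j a b.

Record stretching := Stretching {
  smag : magma;
  scat : strict_cat;
  sproj : magma_hom smag scat;
  br : forall {n : nat} (j : 'I_n.+1) (a b : smag n),
    brdom sproj a b -> smag n.+1;
  cbr : forall (g : bool) {n : nat} (j : 'I_n.+1) (a b : smag n.+1),
    cbrdom sproj g j a b -> smag n.+2;
  face_br_lt : forall r n (i j : 'I_n.+1) (a b : smag n.+1) h, i <= j ->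
    exists h', face r (lo i) (@br _ (up j) a b h)
               = @br _ j (face r i a) (face r i b) h';
  face_br_gt : forall r n (i j : 'I_n.+1) (a b : smag n.+1) h, j <= i ->
    exists h', face r (up i) (@br _ (lo j) a b h)
               = @br _ j (face r i a) (face r i b) h';
  src_br : forall n (j : 'I_n.+1) (a b : smag n) h, src j (@br _ j a b h) = a;
  tgt_br : forall n (j : 'I_n.+1) (a b : smag n) h, tgt j (@br _ j a b h) = b;
  proj_br : forall n (j : 'I_n.+1) (a b : smag n) h,
    sproj _ (@br _ j a b h) = degen j (sproj _ a) /\
    sproj _ (@br _ j a b h) = degen j (sproj _ b);
  br_refl : forall n (j : 'I_n.+1) (a : smag n) h, @br _ j a a h = degen j a;
  face_cbr_same_lo : forall g n (j : 'I_n.+1) (a b : smag n.+1) h,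
    face g (lo j) (@cbr g _ j a b h) = a;
  face_cbr_same_up : forall g n (j : 'I_n.+1) (a b : smag n.+1) h,
    face g (up j) (@cbr g _ j a b h) = b;
  face_cbr_opp_lo : forall g n (j : 'I_n.+1) (a b : smag n.+1) h,
    exists h', face (~~ g) (lo j) (@cbr g _ j a b h)
               = @br _ j (face (~~ g) j a) (face (~~ g) j b) h';
  face_cbr_opp_up : forall g n (j : 'I_n.+1) (a b : smag n.+1) h,
    exists h', face (~~ g) (up j) (@cbr g _ j a b h)
               = @br _ j (face (~~ g) j a) (face (~~ g) j b) h';
  face_cbr_lt : forall r g n (i j : 'I_n.+1) (a b : smag n.+2) h, i <= j ->
    exists h', face r (lo (lo i)) (@cbr g _ (up j) a b h)
               = @cbr g _ j (face r (lo i) a) (face r (lo i) b) h';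
  face_cbr_gt : forall r g n (i j : 'I_n.+1) (a b : smag n.+2) h, j <= i ->
    exists h', face r (up (up i)) (@cbr g _ (lo j) a b h)
               = @cbr g _ j (face r (up i) a) (face r (up i) b) h';
  proj_cbr : forall g n (j : 'I_n.+1) (a b : smag n.+1) h,
    sproj _ (@cbr g _ j a b h) = conn g j (sproj _ a) /\
    sproj _ (@cbr g _ j a b h) = conn g j (sproj _ b);
  cbr_refl : forall g n (j : 'I_n.+1) (a : smag n.+1) h,
    @cbr g _ j a a h = conn g j a }.
Arguments br {s n} j a b h : rename.
Arguments cbr {s} g {n} j a b h : rename.

Record stretching_hom (E E' : stretching) := StretchingHom {
  sh_m : magma_hom (smag E) (smag E');
  sh_c : magma_hom (scat E) (scat E');
  sh_proj : forall n (x : smag E n),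
    sproj E' _ (sh_m _ x) = sh_c _ (sproj E _ x);
  sh_br : forall n (j : 'I_n.+1) (a b : smag E n) h h',
    sh_m _ (br j a b h) = br j (sh_m _ a) (sh_m _ b) h';
  sh_cbr : forall g n (j : 'I_n.+1) (a b : smag E n.+1) h h',
    sh_m _ (cbr g j a b h) = cbr g j (sh_m _ a) (sh_m _ b) h' }.

(* The indices (0,0), (1,0), (0,1), (1,1). *)
Inductive corner := c00 | c10 | c01 | c11.

Record one_magma (M : corner -> magma) := OneMagma {
  omF : cset_hom (M c00) (M c10);
  omG : cset_hom (M c10) (M c11);
  omH : cset_hom (M c00) (M c01);
  omK : cset_hom (M c01) (M c11);
  omtau : M c00 0 -> M c11 1;
  src_omtau : forall a, src ord0 (omtau a) = omG _ (omF _ a);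
  tgt_omtau : forall a, tgt ord0 (omtau a) = omK _ (omH _ a) }.

Record is_one_magma_hom (M M' : corner -> magma) (t : one_magma M)
    (t' : one_magma M') (m : forall i, magma_hom (M i) (M' i)) : Prop :=
  IsOneMagmaHom {
  omh_F : forall n (x : M c00 n), m c10 _ (omF t _ x) = omF t' _ (m c00 _ x);
  omh_G : forall n (x : M c10 n), m c11 _ (omG t _ x) = omG t' _ (m c10 _ x);
  omh_H : forall n (x : M c00 n), m c01 _ (omH t _ x) = omH t' _ (m c00 _ x);
  omh_K : forall n (x : M c01 n), m c11 _ (omK t _ x) = omK t' _ (m c01 _ x);
  omh_tau : forall a, m c11 _ (omtau t a) = omtau t' (m c00 _ a) }.

Record one_trans (C : corner -> strict_cat) := OneTrans {
  otF : magma_hom (C c00) (C c10);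
  otG : magma_hom (C c10) (C c11);
  otH : magma_hom (C c00) (C c01);
  otK : magma_hom (C c01) (C c11);
  ottau : C c00 0 -> C c11 1;
  src_ottau : forall a, src ord0 (ottau a) = otG _ (otF _ a);
  tgt_ottau : forall a, tgt ord0 (ottau a) = otK _ (otH _ a);
  ottau_natural : forall (f : C c00 1) h h',
    circ ord0 (otG _ (otF _ f)) (ottau (tgt ord0 f)) h
    = circ ord0 (ottau (src ord0 f)) (otK _ (otH _ f)) h' }.

Record is_one_trans_hom (C C' : corner -> strict_cat) (t : one_trans C)
    (t' : one_trans C') (c : forall i, magma_hom (C i) (C' i)) : Prop :=
  IsOneTransHom {
  oth_F : forall n (x : C c00 n), c c10 _ (otF t _ x) = otF t' _ (c c00 _ x);
  oth_G : forall n (x : C c10 n), c c11 _ (otG t _ x) = otG t' _ (c c10 _ x);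
  oth_H : forall n (x : C c00 n), c c01 _ (otH t _ x) = otH t' _ (c c00 _ x);
  oth_K : forall n (x : C c01 n), c c11 _ (otK t _ x) = otK t' _ (c c01 _ x);
  oth_tau : forall a, c c11 _ (ottau t a) = ottau t' (c c00 _ a) }.

Record one_stretching := OneStretching {
  os_str : corner -> stretching;
  os_M : one_magma (fun i => smag (os_str i));
  os_C : one_trans (fun i => scat (os_str i));
  os_F : forall n (x : smag (os_str c00) n),
    sproj (os_str c10) _ (omF os_M _ x) = otF os_C _ (sproj (os_str c00) _ x);
  os_G : forall n (x : smag (os_str c10) n),
    sproj (os_str c11) _ (omG os_M _ x) = otG os_C _ (sproj (os_str c10) _ x);
  os_H : forall n (x : smag (os_str c00) n),
    sproj (os_str c01) _ (omH os_M _ x) = otH os_C _ (sproj (os_str c00) _ x);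
  os_K : forall n (x : smag (os_str c01) n),
    sproj (os_str c11) _ (omK os_M _ x) = otK os_C _ (sproj (os_str c01) _ x);
  os_tau : forall a : smag (os_str c00) 0,
    sproj (os_str c11) _ (omtau os_M a) = ottau os_C (sproj (os_str c00) _ a) }.

Record one_stretching_hom (E E' : one_stretching) := OneStretchingHom {
  osh_str : forall i, stretching_hom (os_str E i) (os_str E' i);
  osh_M : is_one_magma_hom (os_M E) (os_M E') (fun i => sh_m (osh_str i));
  osh_C : is_one_trans_hom (os_C E) (os_C E') (fun i => sh_c (osh_str i)) }.

Lemma cset_hom_eq (C D : cset) (f g : cset_hom C D) :
  (forall n (x : C n), f n x = g n x) -> f = g.
Proof.
case: f g => [f hf] [g hg] /= fg.
have e : f = g.
  by apply: functional_extensionality_dep => n; apply: funext => x; exact: fg.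
by move: hf hg; rewrite e => hf hg; rewrite (Prop_irrelevance hf hg).
Qed.

Lemma magma_hom_eq (M N : magma) (f g : magma_hom M N) :
  (forall n (x : M n), f n x = g n x) -> f = g.
Proof.
case: f g => [f f1 f2 f3] [g g1 g2 g3] /= /cset_hom_eq e.
case: _ / e g1 g2 g3 => g1 g2 g3.
by rewrite (Prop_irrelevance f1 g1) (Prop_irrelevance f2 g2)
           (Prop_irrelevance f3 g3).
Qed.

Lemma stretching_hom_eq (E E' : stretching) (f g : stretching_hom E E') :
  (forall n (x : smag E n), sh_m f n x = sh_m g n x) ->
  (forall n (x : scat E n), sh_c f n x = sh_c g n x) -> f = g.
Proof.
case: f g => [m c p1 p2 p3] [m' c' q1 q2 q3] /= /magma_hom_eq e /magma_hom_eq e'.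
case: _ / e q1 q2 q3 => q1 q2 q3; case: _ / e' q1 => q1.
by rewrite (Prop_irrelevance p1 q1) (Prop_irrelevance p2 q2)
           (Prop_irrelevance p3 q3).
Qed.

Lemma one_stretching_hom_eq (E E' : one_stretching)
    (f g : one_stretching_hom E E') :
  (forall i, osh_str f i = osh_str g i) -> f = g.
Proof.
case: f g => [f p1 p2] [g q1 q2] /= fg.
have e : f = g by apply: functional_extensionality_dep.
case: _ / e q1 q2 {fg} => q1 q2.
by rewrite (Prop_irrelevance p1 q1) (Prop_irrelevance p2 q2).
Qed.

Program Definition cset_id (C : cset) : cset_hom C C :=
  @CSetHom C C (fun n x => x) _.
Next Obligation. by []. Qed.

Program Definition cset_comp (C D E : cset) (g : cset_hom D E)
    (f : cset_hom C D) : cset_hom C E :=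
  @CSetHom C E (fun n x => g n (f n x)) _.
Next Obligation. by move=> C D E g f r n j x /=; rewrite !cfun_face. Qed.

Program Definition magma_id (M : magma) : magma_hom M M :=
  @MagmaHom M M (cset_id M) _ _ _.
Next Obligation. by []. Qed.
Next Obligation. by []. Qed.
Next Obligation.
by move=> M n j a b h h' /=; rewrite (Prop_irrelevance h h').
Qed.

Lemma composable_hom (M N : magma) (f : cset_hom M N) n (j : 'I_n.+1)
    (a b : M n.+1) : tgt j a = src j b -> tgt j (f _ a) = src j (f _ b).
Proof. by move=> h; rewrite -!cfun_face h. Qed.

Program Definition magma_comp (M N P : magma) (g : magma_hom N P)
    (f : magma_hom M N) : magma_hom M P :=
  @MagmaHom M P (cset_comp g f) _ _ _.
Next Obligation. by move=> M N P g f n j x /=; rewrite !mfun_degen. Qed.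
Next Obligation. by move=> M N P g f s n j x /=; rewrite !mfun_conn. Qed.
Next Obligation.
move=> M N P g f n j a b h h' /=.
by rewrite (mfun_circ h (composable_hom f h)) (mfun_circ _ h').
Qed.

Program Definition stretching_id (E : stretching) : stretching_hom E E :=
  @StretchingHom E E (magma_id _) (magma_id _) _ _ _.
Next Obligation. by []. Qed.
Next Obligation.
by move=> E n j a b h h' /=; rewrite (Prop_irrelevance h h').
Qed.
Next Obligation.
by move=> E g n j a b h h' /=; rewrite (Prop_irrelevance h h').
Qed.

Lemma brdom_hom (E E' : stretching) (f : stretching_hom E E') n
    (a b : smag E n) :
  brdom (sproj E) a b -> brdom (sproj E') (sh_m f _ a) (sh_m f _ b).
Proof. by case: n a b => [|n] a b /= h; [rewrite h | rewrite !sh_proj h]. Qed.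

Lemma cbrdom_hom (E E' : stretching) (f : stretching_hom E E') g n
    (j : 'I_n.+1) (a b : smag E n.+1) :
  cbrdom (sproj E) g j a b -> cbrdom (sproj E') g j (sh_m f _ a) (sh_m f _ b).
Proof. by case=> h1 h2; split; rewrite -?cfun_face ?h2 ?sh_proj ?h1. Qed.

Program Definition stretching_comp (E E' E'' : stretching)
    (g : stretching_hom E' E'') (f : stretching_hom E E') :
    stretching_hom E E'' :=
  @StretchingHom E E'' (magma_comp (sh_m g) (sh_m f))
    (magma_comp (sh_c g) (sh_c f)) _ _ _.
Next Obligation. by move=> E E' E'' g f n x /=; rewrite !sh_proj. Qed.
Next Obligation.
move=> E E' E'' g f n j a b h h' /=.
by rewrite (sh_br j h (brdom_hom f h)) (sh_br j _ h').
Qed.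
Next Obligation.
move=> E E' E'' g f s n j a b h h' /=.
by rewrite (sh_cbr h (cbrdom_hom f h)) (sh_cbr _ h').
Qed.

Program Definition one_stretching_id (E : one_stretching) :
    one_stretching_hom E E :=
  @OneStretchingHom E E (fun i => stretching_id (os_str E i)) _ _.
Next Obligation. by []. Qed.
Next Obligation. by []. Qed.

Program Definition one_stretching_comp (E E' E'' : one_stretching)
    (g : one_stretching_hom E' E'') (f : one_stretching_hom E E') :
    one_stretching_hom E E'' :=
  @OneStretchingHom E E'' (fun i => stretching_comp (osh_str g i) (osh_str f i))
    _ _.
Next Obligation.
move=> E E' E'' g f.
case: (osh_M g) (osh_M f) => g1 g2 g3 g4 g5 [f1 f2 f3 f4 f5].
by split=> * /=; rewrite ?f1 ?f2 ?f3 ?f4 ?f5 ?g1 ?g2 ?g3 ?g4 ?g5.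
Qed.
Next Obligation.
move=> E E' E'' g f.
case: (osh_C g) (osh_C f) => g1 g2 g3 g4 g5 [f1 f2 f3 f4 f5].
by split=> * /=; rewrite ?f1 ?f2 ?f3 ?f4 ?f5 ?g1 ?g2 ?g3 ?g4 ?g5.
Qed.

Program Definition csets : category :=
  @Category cset cset_hom cset_id cset_comp _ _ _.
Next Obligation. by move=> C D f; apply: cset_hom_eq. Qed.
Next Obligation. by move=> C D f; apply: cset_hom_eq. Qed.
Next Obligation. by move=> C D E F f g h; apply: cset_hom_eq. Qed.

Definition csets4 : category := power_category corner csets.

Program Definition one_stretchings : category :=
  @Category one_stretching one_stretching_hom one_stretching_id
    one_stretching_comp _ _ _.
Next Obligation.
by move=> E E' f; apply: one_stretching_hom_eq => i; apply: stretching_hom_eq.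
Qed.
Next Obligation.
by move=> E E' f; apply: one_stretching_hom_eq => i; apply: stretching_hom_eq.
Qed.
Next Obligation.
move=> E1 E2 E3 E4 f g h.
by apply: one_stretching_hom_eq => i; apply: stretching_hom_eq.
Qed.

Program Definition forgetful : functor one_stretchings csets4 :=
  @Functor one_stretchings csets4
    (fun E i => (smag (os_str E i) : cset))
    (fun E E' f i => (sh_m (osh_str f i) : cset_hom _ _)) _ _.
Next Obligation.
by move=> E; apply: functional_extensionality_dep => i; apply: cset_hom_eq.
Qed.
Next Obligation.
move=> E E' E'' g f.
by apply: functional_extensionality_dep => i; apply: cset_hom_eq.
Qed.

(* Main.v *)
Require Import Defs.
From mathcomp Require Import all_boot.
From mathcomp Require Import boolp.

Set Implicit Arguments.
Unset Strict Implicit.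
Unset Printing Implicit Defensive.

Local Open Scope cat_scope.

(** A one-stretching over a quadruple of cubical sets X is a model of a theory
    whose operations are partial, each defined exactly when some equations
    between its arguments hold, and whose axioms are equations, or equations
    implied by equations.  Such theories have free models; here the free model
    on X is built as follows.

    A cone is a one-stretching with a morphism from X to its four underlying
    cubical sets; in each cone, a raw term over X has at most one value
    ([has_value], [value_unique]), none if it is undefined.  A cell of the free
    model is a term that has a value in all cones, up to having the same value
    in all of them ([free_cell]).  The quantification over all cones lives in
    Prop, so that the cells still form types as small as those of X, and no list
    of derivation rules has to be given.  The values of cells ([sem]) are
    jointly injective ([sem_inj]) and commute with all operations, and an
    operation is defined on cells as soon as it is defined on their values in
    every cone.  Hence each axiom holds in the free model because it holds in
    every cone, including the axioms which assert that a bracket is defined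
    ([eq_fbr], [eq_fcbr]).

    For each cone K, [sem K] is then a morphism from the free model to K
    ([free_ext]).  It is the only one under X: morphisms of cones preserve the
    values of terms ([value_hom]), and a cell of the free model is itself the
    value of any term which represents it ([value_free_cone]).  Universal arrows
    form an adjunction ([free_adjunction]), and every adjunction induces a
    monad ([adjunction_monad]). *)

(** * Universal arrows, adjunctions and monads *)

Section UniversalArrows.
Variables (C D : category) (R : functor D C).
Variables (L : C -> D) (eta : forall X, hom X (R (L X))).
Variable ext : forall X Y, hom X (R Y) -> hom (L X) Y.
Hypothesis extK : forall X Y (f : hom X (R Y)), fmap R (ext f) \oc eta X = f.
Hypothesis ext_uniq : forall X Y (g : hom (L X) Y),
  ext (fmap R g \oc eta X) = g.

(** Morphisms out of a free object are determined by their restriction along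
   the unit. *)
Let hom_free_eq X Y (g g' : hom (L X) Y) :
  fmap R g \oc eta X = fmap R g' \oc eta X -> g = g'.
Proof. by move=> e; rewrite -(ext_uniq g) e ext_uniq. Qed.

Lemma free_fmap_id X : ext (eta X \oc idc X) = idc (L X).
Proof. by apply: hom_free_eq; rewrite extK fmap_id compc_idl compc_idr. Qed.

Lemma free_fmap_comp X Y Z (g : hom Y Z) (f : hom X Y) :
  ext (eta Z \oc (g \oc f)) = ext (eta Z \oc g) \oc ext (eta Y \oc f).
Proof.
apply: hom_free_eq.
by rewrite fmap_comp -compcA !extK !compcA extK.
Qed.

Definition free_functor : functor C D :=
  @Functor C D L (fun X Y f => ext (eta Y \oc f)) free_fmap_id free_fmap_comp.

Lemma free_unit_natural X Y (f : hom X Y) :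
  eta Y \oc f = fmap R (fmap free_functor f) \oc eta X.
Proof. by rewrite extK. Qed.

Lemma free_counit_natural X Y (f : hom X Y) :
  ext (idc (R Y)) \oc fmap free_functor (fmap R f) = f \oc ext (idc (R X)).
Proof.
apply: hom_free_eq.
by rewrite !fmap_comp -!compcA !extK compcA extK compc_idl compc_idr.
Qed.

Lemma free_triangleL X :
  ext (idc (R (L X))) \oc fmap free_functor (eta X) = idc (L X).
Proof.
apply: hom_free_eq.
by rewrite fmap_comp -compcA extK compcA extK fmap_id.
Qed.

Definition free_adjunction : adjunction free_functor R :=
  @Adjunction _ _ free_functor R
    (@NatTrans _ _ (id_functor C) (R \of free_functor) eta free_unit_natural)
    (@NatTrans _ _ (free_functor \of R) (id_functor D)
       (fun Y => ext (idc (R Y))) free_counit_natural)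
    free_triangleL (fun Y => extK (idc (R Y))).

End UniversalArrows.

Lemma adjunction_monad (C D : category) (L : functor C D) (R : functor D C)
    (A : adjunction L R) :
  is_monad (T := R \of L) (adj_unit A) (adj_mult A).
Proof.
split=> X /=; first exact: adj_triangleR.
  by rewrite -fmap_comp adj_triangleL fmap_id.
rewrite -!fmap_comp; congr (fmap R _).
by have /= -> := naturality (adj_counit A) (adj_counit A (L X)).
Qed.

(** * The two layers of a one-stretching *)

(** The arrows of the square formed by the four corners. *)
Inductive edge := edgeF | edgeG | edgeH | edgeK.

Definition edom e :=
  match e with edgeF => c00 | edgeG => c10 | edgeH => c00 | edgeK => c01 end.
Definition ecod e :=
  match e with edgeF => c10 | edgeG => c11 | edgeH => c01 | edgeK => c11 end.

Section Layers.
Variable E : one_stretching.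

(** The magmas M and C get one name, with a boolean that selects the layer, so
    that everything they have in common is constructed and proved once:
    [false] is the layer of the magmas M, [true] that of the strict
    categories C. *)
Definition mag (b : bool) (i : corner) : magma :=
  if b then strict_magma (scat (os_str E i)) else smag (os_str E i).

Definition proj (i : corner) : magma_hom (mag false i) (mag true i) :=
  sproj (os_str E i).

Definition arrow (b : bool) (e : edge) :
    cset_hom (mag b (edom e)) (mag b (ecod e)) :=
  if b return cset_hom (mag b (edom e)) (mag b (ecod e)) then
    match e with
    | edgeF => otF (os_C E) | edgeG => otG (os_C E)
    | edgeH => otH (os_C E) | edgeK => otK (os_C E)
    end
  else
    match e with
    | edgeF => omF (os_M E) | edgeG => omG (os_M E)
    | edgeH => omH (os_M E) | edgeK => omK (os_M E)
    end.

Definition tau (b : bool) : mag b c00 0 -> mag b c11 1 :=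
  if b return mag b c00 0 -> mag b c11 1 then ottau (os_C E)
  else omtau (os_M E).

(** [br] and [cbr] with types that mention [mag], which unification needs to
   find the stretching. *)
Definition mbr i n (j : 'I_n.+1) (x y : mag false i n)
    (h : brdom (proj i) x y) : mag false i n.+1 := @br (os_str E i) n j x y h.

Definition mcbr i g n (j : 'I_n.+1) (x y : mag false i n.+1)
    (h : cbrdom (proj i) g j x y) : mag false i n.+2 :=
  @cbr (os_str E i) g n j x y h.

End Layers.

Definition layer_hom E E' (g : one_stretching_hom E E') b i :
    magma_hom (mag E b i) (mag E' b i) :=
  if b return magma_hom (mag E b i) (mag E' b i)
  then sh_c (osh_str g i) else sh_m (osh_str g i).

(** The arrows of the layer C with their structure of morphisms of magmas, which
    those of the layer M are not required to have. *)
Definition strict_arrow (E : one_stretching) e :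
    magma_hom (mag E true (edom e)) (mag E true (ecod e)) :=
  match e with
  | edgeF => otF (os_C E) | edgeG => otG (os_C E)
  | edgeH => otH (os_C E) | edgeK => otK (os_C E)
  end.

Lemma arrow_strict E e n x : arrow E true e n x = strict_arrow E e n x.
Proof. by case: e x. Qed.

Lemma src_tau (E : one_stretching) b (x : mag E b c00 0) :
  src ord0 (tau x) = arrow E b edgeG 0 (arrow E b edgeF 0 x).
Proof. by case: b x => x; [exact: src_ottau | exact: src_omtau]. Qed.

Lemma tgt_tau (E : one_stretching) b (x : mag E b c00 0) :
  tgt ord0 (tau x) = arrow E b edgeK 0 (arrow E b edgeH 0 x).
Proof. by case: b x => x; [exact: tgt_ottau | exact: tgt_omtau]. Qed.

Lemma proj_arrow (E : one_stretching) e n (x : mag E false (edom e) n) :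
  proj E (ecod e) n (arrow E false e n x)
  = arrow E true e n (proj E (edom e) n x).
Proof.
by case: e x => x; [exact: os_F | exact: os_G | exact: os_H | exact: os_K].
Qed.

Lemma layer_hom_proj E E' (g : one_stretching_hom E E') i n
    (x : mag E false i n) :
  layer_hom g true i n (proj E i n x) = proj E' i n (layer_hom g false i n x).
Proof. by rewrite /= sh_proj. Qed.

Lemma layer_hom_arrow E E' (g : one_stretching_hom E E') b e n
    (x : mag E b (edom e) n) :
  layer_hom g b (ecod e) n (arrow E b e n x)
  = arrow E' b e n (layer_hom g b (edom e) n x).
Proof.
case: (osh_M g) (osh_C g) => ? ? ? ? ? [? ? ? ? ?].
by case: b e x => -[] /=.
Qed.

Lemma layer_hom_tau E E' (g : one_stretching_hom E E') b (x : mag E b c00 0) :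
  layer_hom g b c11 1 (tau x) = tau (layer_hom g b c00 0 x).
Proof.
case: (osh_M g) (osh_C g) => ? ? ? ? ? [? ? ? ? ?].
by case: b x => /=.
Qed.

(** * Terms and their values *)

(** Raw terms for all operations, applied regardless of whether they are
    defined. *)
Inductive term (X : corner -> cset) : bool -> corner -> nat -> Type :=
| Gen i n : X i n -> term X false i n
| Face b i (r : bool) n (j : 'I_n.+1) : term X b i n.+1 -> term X b i n
| Degen b i n (j : 'I_n.+1) : term X b i n -> term X b i n.+1
| Conn b i (g : bool) n (j : 'I_n.+1) : term X b i n.+1 -> term X b i n.+2
| Circ b i n (j : 'I_n.+1) :
    term X b i n.+1 -> term X b i n.+1 -> term X b i n.+1
| Proj i n : term X false i n -> term X true i n
| Br i n (j : 'I_n.+1) :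
    term X false i n -> term X false i n -> term X false i n.+1
| Cbr i (g : bool) n (j : 'I_n.+1) :
    term X false i n.+1 -> term X false i n.+1 -> term X false i n.+2
| Arr b e n : term X b (edom e) n -> term X b (ecod e) n
| Tau b : term X b c00 0 -> term X b c11 1.

Arguments Gen {X i n} x.
Arguments Arr {X b} e {n} t.

Section Free.
Variable X : corner -> cset.

Record cone := Cone {
  apex :> one_stretching;
  leg : forall i, cset_hom (X i) (mag apex false i) }.

(** A relation, rather than a partial function, spares any decision on the
    domains of the partial operations: [has_value t v] includes that [t] is
    defined in [K]. *)
Fixpoint has_value (K : cone) b i n (t : term X b i n) : mag K b i n -> Prop :=
  match t in term _ b i n return mag K b i n -> Prop with
  | Gen i n x => fun v => v = leg K i n x
  | Face b i r n j t => fun v => exists2 x, has_value t x & v = face r j x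
  | Degen b i n j t => fun v => exists2 x, has_value t x & v = degen j x
  | Conn b i g n j t => fun v => exists2 x, has_value t x & v = conn g j x
  | Circ b i n j t u => fun v =>
      exists x y, [/\ has_value t x, has_value u y & exists h, v = circ j x y h]
  | Proj i n t => fun v => exists2 x, has_value t x & v = proj K i n x
  | Br i n j t u => fun v =>
      exists x y,
        [/\ has_value t x, has_value u y & exists h, v = @mbr K i n j x y h]
  | Cbr i g n j t u => fun v =>
      exists x y,
        [/\ has_value t x, has_value u y & exists h, v = @mcbr K i g n j x y h]
  | Arr b e n t => fun v => exists2 x, has_value t x & v = arrow K b e n x
  | Tau b t => fun v => exists2 x, has_value t x & v = tau x
  end.

Lemma value_unique (K : cone) b i n (t : term X b i n) (v w : mag K b i n) :
  has_value t v -> has_value t w -> v = w.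
Proof.
elim: t v w => {b i n} /=.
- by move=> i n x v w -> ->.
- by move=> b i r n j t IH _ _ [x tx ->] [y ty ->]; rewrite (IH _ _ tx ty).
- by move=> b i n j t IH _ _ [x tx ->] [y ty ->]; rewrite (IH _ _ tx ty).
- by move=> b i g n j t IH _ _ [x tx ->] [y ty ->]; rewrite (IH _ _ tx ty).
- move=> b i n j t IHt u IHu _ _ [x [y [tx uy [h ->]]]]
    [x' [y' [tx' uy' [h' ->]]]].
  move: h h'; rewrite (IHt _ _ tx tx') (IHu _ _ uy uy') => h h'.
  by rewrite (Prop_irrelevance h h').
- by move=> i n t IH _ _ [x tx ->] [y ty ->]; rewrite (IH _ _ tx ty).
- move=> i n j t IHt u IHu _ _ [x [y [tx uy [h ->]]]]
    [x' [y' [tx' uy' [h' ->]]]].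
  move: h h'; rewrite (IHt _ _ tx tx') (IHu _ _ uy uy') => h h'.
  by rewrite (Prop_irrelevance h h').
- move=> i g n j t IHt u IHu _ _ [x [y [tx uy [h ->]]]]
    [x' [y' [tx' uy' [h' ->]]]].
  move: h h'; rewrite (IHt _ _ tx tx') (IHu _ _ uy uy') => h h'.
  by rewrite (Prop_irrelevance h h').
- by move=> b e n t IH _ _ [x tx ->] [y ty ->]; rewrite (IH _ _ tx ty).
- by move=> b t IH _ _ [x tx ->] [y ty ->]; rewrite (IH _ _ tx ty).
Qed.

(** Morphisms under X preserve definedness and values: the domain conditions of
    the partial operations are equations, which morphisms preserve. *)
Lemma value_hom (K K' : cone) (g : one_stretching_hom K K') :
  (forall i n (x : X i n),
     layer_hom g false i n (leg K i n x) = leg K' i n x) ->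
  forall b i n (t : term X b i n) (v : mag K b i n),
    has_value t v -> has_value t (layer_hom g b i n v).
Proof.
move=> gleg b i n t; elim: t => {b i n} /=.
- by move=> i n x v ->; exact: gleg.
- move=> b i r n j t IH _ [x /IH tx ->]; eexists; first exact: tx.
  exact: cfun_face.
- move=> b i n j t IH _ [x /IH tx ->]; eexists; first exact: tx.
  exact: mfun_degen.
- move=> b i s n j t IH _ [x /IH tx ->]; eexists; first exact: tx.
  exact: mfun_conn.
- move=> b i n j t IHt u IHu _ [x [y [/IHt tx /IHu uy [h ->]]]].
  exists (layer_hom g b i n.+1 x), (layer_hom g b i n.+1 y); split=> //.
  by exists (composable_hom (layer_hom g b i) h); exact: mfun_circ.
- move=> i n t IH _ [x /IH tx ->]; eexists; first exact: tx.
  exact: (layer_hom_proj g).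
- move=> i n j t IHt u IHu _ [x [y [/IHt tx /IHu uy [h ->]]]].
  exists (layer_hom g false i n x), (layer_hom g false i n y); split=> //.
  by exists (brdom_hom (osh_str g i) h); exact: sh_br.
- move=> i s n j t IHt u IHu _ [x [y [/IHt tx /IHu uy [h ->]]]].
  exists (layer_hom g false i n.+1 x), (layer_hom g false i n.+1 y); split=> //.
  by exists (cbrdom_hom (osh_str g i) h); exact: sh_cbr.
- move=> b e n t IH _ [x /IH tx ->]; eexists; first exact: tx.
  exact: (layer_hom_arrow g).
- move=> b t IH _ [x /IH tx ->]; eexists; first exact: tx.
  exact: layer_hom_tau.
Qed.

(** * Cells of the free one-stretching *)

Definition defined b i n (t : term X b i n) :=
  forall K : cone, exists v : mag K b i n, has_value t v.

Definition equiv b i n (t u : term X b i n) : Prop :=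
  forall K : cone, @has_value K b i n t = has_value u.

(** The quotient of the defined terms by [equiv], as the type of its equivalence
    classes. *)
Record free_cell b i n := FreeCell {
  cell_class : term X b i n -> Prop;
  cell_classP : exists2 t, defined t & cell_class = equiv t }.

Definition repr b i n (x : free_cell b i n) : term X b i n :=
  s2val (cid2 (cell_classP x)).

Lemma repr_defined b i n (x : free_cell b i n) : defined (repr x).
Proof. by rewrite /repr; case: cid2. Qed.

Lemma cell_class_repr b i n (x : free_cell b i n) :
  cell_class x = equiv (repr x).
Proof. by rewrite /repr; case: cid2. Qed.

Definition sem (K : cone) b i n (x : free_cell b i n) : mag K b i n :=
  sval (cid (repr_defined x K)).

Lemma value_repr (K : cone) b i n (x : free_cell b i n) :
  has_value (repr x) (sem K x).
Proof. by rewrite /sem; case: cid. Qed.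

(** Cells are equal as soon as their values in all cones are: every axiom of the
    free one-stretching is reduced by this to the same axiom in a cone. *)
Lemma sem_inj b i n (x y : free_cell b i n) :
  (forall K, sem K x = sem K y) -> x = y.
Proof.
move=> xy; have rxy : equiv (repr x) (repr y).
  move=> K; apply: funext => v; apply: propext.
  have vx := value_repr K x; have vy := value_repr K y; rewrite -xy in vy.
  by split=> [/value_unique/(_ vx) -> | /value_unique/(_ vy) ->].
have : cell_class x = cell_class y.
  rewrite !cell_class_repr; apply: funext => t; apply: propext.
  by split=> e K; rewrite -(e K) (rxy K).
case: x y {xy rxy} => [P hP] [Q hQ] /= e; case: _ / e hQ => hQ.
by rewrite (Prop_irrelevance hP hQ).
Qed.

(** Each operation on cells is given by a term together with its value in every
    cone, which is then the value of the cell produced ([sem_realize]). *)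
Section Realize.
Variables (b : bool) (i : corner) (n : nat) (t : term X b i n).
Variable phi : forall K : cone, mag K b i n.
Hypothesis phi_value : forall K, has_value t (phi K).

Definition realize : free_cell b i n :=
  FreeCell (ex_intro2 (fun u => defined u) (fun u => equiv t = equiv u) t
    (fun K => ex_intro _ (phi K) (phi_value K)) erefl).

Lemma sem_realize K : sem K realize = phi K.
Proof.
suff e : @has_value K b i n (repr realize) = has_value t.
  by apply: value_unique (phi_value K); rewrite -e; exact: value_repr.
have : equiv (repr realize) t by rewrite -cell_class_repr.
exact.
Qed.
End Realize.

(** * Free cubical sets and free magmas *)

Lemma value_face (K : cone) b i r n (j : 'I_n.+1) (x : free_cell b i n.+1) :
  has_value (Face r j (repr x)) (face r j (sem K x)).
Proof. by exists (sem K x) => //; exact: value_repr. Qed.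

Definition fface b i r n (j : 'I_n.+1) (x : free_cell b i n.+1) :
  free_cell b i n := realize (fun K => value_face K r j x).

Lemma sem_face K b i r n j x :
  sem K (@fface b i r n j x) = face r j (sem K x).
Proof. exact: sem_realize. Qed.

Lemma free_face_face b i r r' n (i0 j : 'I_n.+1) (x : free_cell b i n.+2) :
  i0 <= j -> fface r i0 (fface r' (up j) x) = fface r' j (fface r (lo i0) x).
Proof.
by move=> ij; apply: sem_inj => K; rewrite !sem_face face_face.
Qed.

Definition free_cset b i : cset := CSet (@free_face_face b i).

Lemma value_degen (K : cone) b i n (j : 'I_n.+1) (x : free_cell b i n) :
  has_value (Degen j (repr x)) (degen j (sem K x)).
Proof. by exists (sem K x) => //; exact: value_repr. Qed.

Definition fdegen b i n (j : 'I_n.+1) (x : free_cset b i n) :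
  free_cset b i n.+1 := realize (fun K => value_degen K j x).

Lemma sem_degen K b i n j x :
  sem K (@fdegen b i n j x) = degen j (sem K x).
Proof. exact: sem_realize. Qed.

Lemma value_conn (K : cone) b i g n (j : 'I_n.+1) (x : free_cell b i n.+1) :
  has_value (Conn g j (repr x)) (conn g j (sem K x)).
Proof. by exists (sem K x) => //; exact: value_repr. Qed.

Definition fconn b i g n (j : 'I_n.+1) (x : free_cset b i n.+1) :
  free_cset b i n.+2 := realize (fun K => value_conn K g j x).

Lemma sem_conn K b i g n j x :
  sem K (@fconn b i g n j x) = conn g j (sem K x).
Proof. exact: sem_realize. Qed.

Definition semE := (@sem_face, @sem_degen, @sem_conn).

Definition free_rcset (b : bool) (i : corner) : rcset.
Proof.
apply: (@RCSet (free_cset b i) (@fdegen b i) (@fconn b i)) => *;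
  apply: sem_inj => K; rewrite !semE.
- exact: degen_degen.
- exact: face_degen_lt.
- exact: face_degen_gt.
- exact: face_degen_eq.
- exact: conn_conn.
- exact: conn_degen_lt.
- exact: conn_degen_gt.
- exact: conn_degen_eq.
- exact: face_conn_lt.
- exact: face_conn_gt.
- exact: face_conn_same_lo.
- exact: face_conn_same_up.
- exact: face_conn_opp_lo.
- exact: face_conn_opp_up.
Defined.

Lemma sem_composable (K : cone) b i n (j : 'I_n.+1)
    (x y : free_rcset b i n.+1) :
  tgt j x = src j y -> tgt j (sem K x) = src j (sem K y).
Proof. by move=> h; rewrite -!sem_face; congr (sem K _). Qed.

Lemma value_circ (K : cone) b i n (j : 'I_n.+1) (x y : free_rcset b i n.+1)
    (h : tgt j x = src j y) :
  has_value (Circ j (repr x) (repr y)) (circ j _ _ (sem_composable K h)).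
Proof.
exists (sem K x), (sem K y); split; [exact: value_repr | exact: value_repr |].
by exists (sem_composable K h).
Qed.

Definition fcirc b i n (j : 'I_n.+1) (x y : free_rcset b i n.+1)
    (h : tgt j x = src j y) : free_rcset b i n.+1 :=
  realize (fun K => value_circ K h).

(** The values of the arguments are replaced by given equal ones, because the
    composability proof in the conclusion prevents rewriting them
    afterwards. *)
Lemma sem_circ K b i n (j : 'I_n.+1) (x y : free_rcset b i n.+1)
    (h : tgt j x = src j y) u v :
  sem K x = u -> sem K y = v ->
  exists h', sem K (fcirc h) = circ j u v h'.
Proof. by move=> <- <-; exists (sem_composable K h); exact: sem_realize. Qed.

Arguments sem_circ K {b i n j x y} h {u v} _ _.

Definition free_magma (b : bool) (i : corner) : magma.
Proof.
apply: (@Defs.Magma (free_rcset b i) (@fcirc b i)).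
- move=> n j x y h; apply: sem_inj => K; rewrite !sem_face.
  by have [h' ->] := sem_circ K h erefl erefl; exact: src_circ.
- move=> n j x y h; apply: sem_inj => K; rewrite !sem_face.
  by have [h' ->] := sem_circ K h erefl erefl; exact: tgt_circ.
- move=> r n k j x y h h' kj; apply: sem_inj => K; rewrite sem_face.
  have [e ->] := sem_circ K h erefl erefl.
  have [e' ->] := sem_circ K h' (sem_face _ _ _ _) (sem_face _ _ _ _).
  exact: face_circ_lt.
- move=> r n k j x y h h' kj; apply: sem_inj => K; rewrite sem_face.
  have [e ->] := sem_circ K h erefl erefl.
  have [e' ->] := sem_circ K h' (sem_face _ _ _ _) (sem_face _ _ _ _).
  exact: face_circ_gt.
Defined.

Lemma free_strict i : is_strict (free_magma true i).
Proof.
split.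
- move=> n j x y z hxy hyz h h'; apply: sem_inj => K.
  have [? e1] := sem_circ K hxy erefl erefl.
  have [? e2] := sem_circ K hyz erefl erefl.
  have [? ->] := sem_circ K h e1 erefl.
  have [? ->] := sem_circ K h' erefl e2.
  exact: (circ_assoc (strict_laws _)).
- move=> n j x h; apply: sem_inj => K.
  have [? ->] := sem_circ K h
    (etrans (sem_degen _ _ _) (congr1 (degen j) (sem_face _ _ _ _))) erefl.
  exact: (circ_unitl (strict_laws _)).
- move=> n j x h; apply: sem_inj => K.
  have [? ->] := sem_circ K h erefl
    (etrans (sem_degen _ _ _) (congr1 (degen j) (sem_face _ _ _ _))).
  exact: (circ_unitr (strict_laws _)).
- move=> n k j x y z w hxy hzw hxz hyw h h' kj; apply: sem_inj => K.
  have [? e1] := sem_circ K hxy erefl erefl.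
  have [? e2] := sem_circ K hzw erefl erefl.
  have [? e3] := sem_circ K hxz erefl erefl.
  have [? e4] := sem_circ K hyw erefl erefl.
  have [? ->] := sem_circ K h e1 e2.
  have [? ->] := sem_circ K h' e3 e4.
  exact: (circ_interchange (strict_laws _)).
- move=> n k j x y h h' kj; apply: sem_inj => K; rewrite sem_degen.
  have [? ->] := sem_circ K h erefl erefl.
  have [? ->] := sem_circ K h' (sem_degen _ _ _) (sem_degen _ _ _).
  exact: (degen_circ_le (strict_laws _)).
- move=> n k j x y h h' kj; apply: sem_inj => K; rewrite sem_degen.
  have [? ->] := sem_circ K h erefl erefl.
  have [? ->] := sem_circ K h' (sem_degen _ _ _) (sem_degen _ _ _).
  exact: (degen_circ_gt (strict_laws _)).
- move=> g n k j x y h h' kj; apply: sem_inj => K; rewrite sem_conn.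
  have [? ->] := sem_circ K h erefl erefl.
  have [? ->] := sem_circ K h' (sem_conn _ _ _ _) (sem_conn _ _ _ _).
  exact: (conn_circ_lt (strict_laws _)).
- move=> g n k j x y h h' kj; apply: sem_inj => K; rewrite sem_conn.
  have [? ->] := sem_circ K h erefl erefl.
  have [? ->] := sem_circ K h' (sem_conn _ _ _ _) (sem_conn _ _ _ _).
  exact: (conn_circ_gt (strict_laws _)).
- move=> n j x y h h1 h2 h'; apply: sem_inj => K; rewrite sem_conn.
  have [? ->] := sem_circ K h erefl erefl.
  have [? e1] := sem_circ K h1 (sem_conn _ _ _ _) (sem_degen _ _ _).
  have [? e2] := sem_circ K h2 (sem_degen _ _ _) (sem_conn _ _ _ _).
  have [? ->] := sem_circ K h' e1 e2.
  exact: (transport_plus (strict_laws _)).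
- move=> n j x y h h1 h2 h'; apply: sem_inj => K; rewrite sem_conn.
  have [? ->] := sem_circ K h erefl erefl.
  have [? e1] := sem_circ K h1 (sem_conn _ _ _ _) (sem_degen _ _ _).
  have [? e2] := sem_circ K h2 (sem_degen _ _ _) (sem_conn _ _ _ _).
  have [? ->] := sem_circ K h' e1 e2.
  exact: (transport_minus (strict_laws _)).
- move=> n k x h; apply: sem_inj => K; rewrite sem_degen.
  have [? ->] := sem_circ K h (sem_conn _ _ _ _) (sem_conn _ _ _ _).
  exact: (conn_cancel_lo (strict_laws _)).
- move=> n k x h; apply: sem_inj => K; rewrite sem_degen.
  have [? ->] := sem_circ K h (sem_conn _ _ _ _) (sem_conn _ _ _ _).
  exact: (conn_cancel_up (strict_laws _)).
Qed.

(** * Projections and brackets *)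

Lemma value_proj (K : cone) i n (x : free_cell false i n) :
  has_value (Proj (repr x)) (proj K i n (sem K x)).
Proof. by exists (sem K x) => //; exact: value_repr. Qed.

Definition fproj i n (x : free_magma false i n) : free_magma true i n :=
  realize (fun K => value_proj K x).

Lemma sem_proj K i n x : sem K (@fproj i n x) = proj K i n (sem K x).
Proof. exact: sem_realize. Qed.

Definition free_proj_cset i :
  cset_hom (free_magma false i) (free_magma true i).
Proof.
apply: (@CSetHom _ _ (@fproj i)) => r n j x; apply: sem_inj => K.
by rewrite !(sem_proj, sem_face) cfun_face.
Defined.

Definition free_proj i : magma_hom (free_magma false i) (free_magma true i).
Proof.
apply: (@MagmaHom _ _ (free_proj_cset i)).
- move=> n j x; apply: sem_inj => K.
  by rewrite !(sem_proj, sem_degen) mfun_degen.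
- move=> g n j x; apply: sem_inj => K.
  by rewrite !(sem_proj, sem_conn) mfun_conn.
- move=> n j x y h h'; apply: sem_inj => K; rewrite sem_proj.
  have [? ->] := sem_circ K h erefl erefl.
  have [? ->] := sem_circ K h' (sem_proj _ _) (sem_proj _ _).
  exact: mfun_circ.
Defined.

(** Domains of brackets are detected in cones, since they are given by
    equations between cells, in dimension 0 as in higher dimensions. *)
Lemma brdom_sem i n (x y : free_magma false i n) :
  brdom (free_proj i) x y <->
  forall K : cone, brdom (proj K i) (sem K x) (sem K y).
Proof.
case: n x y => [|n] x y /=; split=> h.
- by rewrite h.
- exact: sem_inj.
- by move=> K; rewrite -!sem_proj h.
- by apply: sem_inj => K; rewrite [LHS]sem_proj [RHS]sem_proj; exact: h.
Qed.

Lemma cbrdom_sem i g n (j : 'I_n.+1) (x y : free_magma false i n.+1) :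
  cbrdom (free_proj i) g j x y <->
  forall K : cone, cbrdom (proj K i) g j (sem K x) (sem K y).
Proof.
split=> [[h1 h2] K | h]; split.
- by rewrite -!sem_proj; congr (sem K _).
- by rewrite -!sem_face; congr (sem K _).
- by apply: sem_inj => K; rewrite !sem_proj; have [] := h K.
- by apply: sem_inj => K; rewrite !sem_face; have [] := h K.
Qed.

Lemma value_br (K : cone) i n (j : 'I_n.+1) (x y : free_magma false i n)
    (h : brdom (free_proj i) x y) :
  has_value (Br j (repr x) (repr y)) (mbr j ((brdom_sem x y).1 h K)).
Proof.
exists (sem K x), (sem K y); split; [exact: value_repr | exact: value_repr |].
by eexists.
Qed.

Definition fbr i n (j : 'I_n.+1) (x y : free_magma false i n)
    (h : brdom (free_proj i) x y) : free_magma false i n.+1 :=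
  realize (fun K => value_br K j h).

Lemma sem_br K i n (j : 'I_n.+1) (x y : free_magma false i n)
    (h : brdom (free_proj i) x y) u v :
  sem K x = u -> sem K y = v ->
  exists h', sem K (fbr j h) = mbr (i := i) (x := u) (y := v) j h'.
Proof. by move=> <- <-; eexists; exact: sem_realize. Qed.

Arguments sem_br K {i n} j {x y} h {u v} _ _.

Lemma value_cbr (K : cone) i g n (j : 'I_n.+1) (x y : free_magma false i n.+1)
    (h : cbrdom (free_proj i) g j x y) :
  has_value (Cbr g j (repr x) (repr y)) (mcbr ((cbrdom_sem g j x y).1 h K)).
Proof.
exists (sem K x), (sem K y); split; [exact: value_repr | exact: value_repr |].
by eexists.
Qed.

Definition fcbr i g n (j : 'I_n.+1) (x y : free_magma false i n.+1)
    (h : cbrdom (free_proj i) g j x y) : free_magma false i n.+2 :=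
  realize (fun K => value_cbr K h).

Lemma sem_cbr K i g n (j : 'I_n.+1) (x y : free_magma false i n.+1)
    (h : cbrdom (free_proj i) g j x y) u v :
  sem K x = u -> sem K y = v ->
  exists h', sem K (fcbr h)
             = mcbr (i := i) (g := g) (j := j) (x := u) (y := v) h'.
Proof. by move=> <- <-; eexists; exact: sem_realize. Qed.

Arguments sem_cbr K {i g n j x y} h {u v} _ _.

(** That a bracket on the right-hand side of an axiom is defined is itself read
    off in the cones, where the axiom provides it.  For brackets of 0-cells this
    is an equality of 0-cells. *)
Lemma eq_fbr i n (j : 'I_n.+1) z (x y : free_magma false i n) :
  (forall K : cone, exists u v, [/\ sem K x = u, sem K y = v &
     exists h, sem K z = mbr (i := i) (x := u) (y := v) j h]) ->
  exists h, z = fbr (x := x) (y := y) j h.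
Proof.
move=> H; have h : brdom (free_proj i) x y.
  by apply/brdom_sem => K; have [_ [_ [<- <- [h _]]]] := H K.
exists h; apply: sem_inj => K; have [u [v [xu yv [e ->]]]] := H K.
by have [e' ->] := sem_br K j h xu yv; rewrite (Prop_irrelevance e e').
Qed.

Lemma eq_fcbr i g n (j : 'I_n.+1) z (x y : free_magma false i n.+1) :
  (forall K : cone, exists u v, [/\ sem K x = u, sem K y = v &
     exists h, sem K z
               = mcbr (i := i) (g := g) (j := j) (x := u) (y := v) h]) ->
  exists h, z = fcbr (g := g) (j := j) (x := x) (y := y) h.
Proof.
move=> H; have h : cbrdom (free_proj i) g j x y.
  by apply/cbrdom_sem => K; have [_ [_ [<- <- [h _]]]] := H K.
exists h; apply: sem_inj => K; have [u [v [xu yv [e ->]]]] := H K.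
by have [e' ->] := sem_cbr K h xu yv; rewrite (Prop_irrelevance e e').
Qed.

Definition free_stretching (i : corner) : stretching.
Proof.
apply: (@Stretching (free_magma false i) (StrictCat (free_strict i))
  (free_proj i) (@fbr i) (@fcbr i)).
- move=> r n k j x y h kj; apply: eq_fbr => K.
  do 2!eexists; split; [exact: sem_face | exact: sem_face |].
  rewrite sem_face; have [e ->] := sem_br K (up j) h erefl erefl.
  exact: face_br_lt.
- move=> r n k j x y h kj; apply: eq_fbr => K.
  do 2!eexists; split; [exact: sem_face | exact: sem_face |].
  rewrite sem_face; have [e ->] := sem_br K (lo j) h erefl erefl.
  exact: face_br_gt.
- move=> n j x y h; apply: sem_inj => K; rewrite sem_face.
  by have [e ->] := sem_br K j h erefl erefl; exact: src_br.
- move=> n j x y h; apply: sem_inj => K; rewrite sem_face.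
  by have [e ->] := sem_br K j h erefl erefl; exact: tgt_br.
- move=> n j x y h; split; apply: sem_inj => K.
    rewrite sem_degen !sem_proj; have [e ->] := sem_br K j h erefl erefl.
    exact: (proj_br _ _).1.
  rewrite sem_degen !sem_proj; have [e ->] := sem_br K j h erefl erefl.
  exact: (proj_br _ _).2.
- move=> n j x h; apply: sem_inj => K; rewrite sem_degen.
  by have [e ->] := sem_br K j h erefl erefl; exact: br_refl.
- move=> g n j x y h; apply: sem_inj => K; rewrite sem_face.
  by have [e ->] := sem_cbr K h erefl erefl; exact: face_cbr_same_lo.
- move=> g n j x y h; apply: sem_inj => K; rewrite sem_face.
  by have [e ->] := sem_cbr K h erefl erefl; exact: face_cbr_same_up.
- move=> g n j x y h; apply: eq_fbr => K.
  do 2!eexists; split; [exact: sem_face | exact: sem_face |].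
  rewrite sem_face; have [e ->] := sem_cbr K h erefl erefl.
  exact: face_cbr_opp_lo.
- move=> g n j x y h; apply: eq_fbr => K.
  do 2!eexists; split; [exact: sem_face | exact: sem_face |].
  rewrite sem_face; have [e ->] := sem_cbr K h erefl erefl.
  exact: face_cbr_opp_up.
- move=> r g n k j x y h kj; apply: eq_fcbr => K.
  do 2!eexists; split; [exact: sem_face | exact: sem_face |].
  rewrite sem_face; have [e ->] := sem_cbr K h erefl erefl.
  exact: face_cbr_lt.
- move=> r g n k j x y h kj; apply: eq_fcbr => K.
  do 2!eexists; split; [exact: sem_face | exact: sem_face |].
  rewrite sem_face; have [e ->] := sem_cbr K h erefl erefl.
  exact: face_cbr_gt.
- move=> g n j x y h; split; apply: sem_inj => K.
    rewrite sem_conn !sem_proj; have [e ->] := sem_cbr K h erefl erefl.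
    exact: (proj_cbr _).1.
  rewrite sem_conn !sem_proj; have [e ->] := sem_cbr K h erefl erefl.
  exact: (proj_cbr _).2.
- move=> g n j x h; apply: sem_inj => K; rewrite sem_conn.
  by have [e ->] := sem_cbr K h erefl erefl; exact: cbr_refl.
Defined.

(** * The square of arrows and the transformations *)

Lemma value_arr (K : cone) b e n (x : free_cell b (edom e) n) :
  has_value (Arr e (repr x)) (arrow K b e n (sem K x)).
Proof. by exists (sem K x) => //; exact: value_repr. Qed.

Definition farr b e n (x : free_magma b (edom e) n) :
  free_magma b (ecod e) n := realize (fun K => value_arr K x).

Lemma sem_arr K b e n x : sem K (@farr b e n x) = arrow K b e n (sem K x).
Proof. exact: sem_realize. Qed.

Definition free_arrow b e :
  cset_hom (free_magma b (edom e)) (free_magma b (ecod e)).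
Proof.
apply: (@CSetHom _ _ (@farr b e)) => r n j x; apply: sem_inj => K.
by rewrite !(sem_arr, sem_face) cfun_face.
Defined.

Definition free_strict_arrow e :
  magma_hom (free_magma true (edom e)) (free_magma true (ecod e)).
Proof.
apply: (@MagmaHom _ _ (free_arrow true e)).
- move=> n j x; apply: sem_inj => K.
  by rewrite !(sem_arr, sem_degen) !arrow_strict mfun_degen.
- move=> g n j x; apply: sem_inj => K.
  by rewrite !(sem_arr, sem_conn) !arrow_strict mfun_conn.
- move=> n j x y h h'; apply: sem_inj => K; rewrite sem_arr arrow_strict.
  have [? ->] := sem_circ K h erefl erefl.
  have [? ->] := sem_circ K h'
    (etrans (sem_arr _ _) (arrow_strict _))
    (etrans (sem_arr _ _) (arrow_strict _)).
  exact: mfun_circ.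
Defined.

Lemma value_tau (K : cone) b (x : free_cell b c00 0) :
  has_value (Tau (repr x)) (tau (sem K x)).
Proof. by exists (sem K x) => //; exact: value_repr. Qed.

Definition ftau b (x : free_magma b c00 0) : free_magma b c11 1 :=
  realize (fun K => value_tau K x).

Lemma sem_tau K b x : sem K (@ftau b x) = tau (sem K x).
Proof. exact: sem_realize. Qed.

Lemma src_ftau b (x : free_magma b c00 0) :
  src ord0 (ftau x) = free_arrow b edgeG 0 (free_arrow b edgeF 0 x).
Proof.
apply: sem_inj => K; rewrite sem_face sem_tau src_tau.
by rewrite (@sem_arr K b edgeG) (@sem_arr K b edgeF).
Qed.

Lemma tgt_ftau b (x : free_magma b c00 0) :
  tgt ord0 (ftau x) = free_arrow b edgeK 0 (free_arrow b edgeH 0 x).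
Proof.
apply: sem_inj => K; rewrite sem_face sem_tau tgt_tau.
by rewrite (@sem_arr K b edgeK) (@sem_arr K b edgeH).
Qed.

Definition free_one_magma : one_magma (fun i => smag (free_stretching i)) :=
  @OneMagma (fun i => smag (free_stretching i))
    (free_arrow false edgeF) (free_arrow false edgeG)
    (free_arrow false edgeH) (free_arrow false edgeK)
    (@ftau false) (@src_ftau false) (@tgt_ftau false).

Definition free_one_trans : one_trans (fun i => scat (free_stretching i)).
Proof.
apply: (@OneTrans (fun i => scat (free_stretching i))
  (free_strict_arrow edgeF) (free_strict_arrow edgeG)
  (free_strict_arrow edgeH) (free_strict_arrow edgeK)
  (@ftau true) (@src_ftau true) (@tgt_ftau true)) => x h h'.
apply: sem_inj => K.
have GF : sem K (free_arrow true edgeG 1 (free_arrow true edgeF 1 x))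
          = otG (os_C K) _ (otF (os_C K) _ (sem K x)).
  by rewrite (@sem_arr K true edgeG) (@sem_arr K true edgeF).
have KH : sem K (free_arrow true edgeK 1 (free_arrow true edgeH 1 x))
          = otK (os_C K) _ (otH (os_C K) _ (sem K x)).
  by rewrite (@sem_arr K true edgeK) (@sem_arr K true edgeH).
have tauface r : sem K (ftau (face r ord0 x : free_magma true c00 0))
                 = ottau (os_C K) (face r ord0 (sem K x)).
  by rewrite (@sem_tau K true) sem_face.
have [? ->] := sem_circ K h GF (tauface true).
have [? ->] := sem_circ K h' (tauface false) KH.
exact: ottau_natural.
Defined.

Lemma free_proj_arrow e n (x : free_magma false (edom e) n) :
  free_proj (ecod e) n (free_arrow false e n x)
  = free_arrow true e n (free_proj (edom e) n x).
Proof.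
apply: sem_inj => K.
by rewrite sem_proj (@sem_arr K true) (@sem_arr K false) sem_proj proj_arrow.
Qed.

Lemma free_proj_tau (x : free_magma false c00 0) :
  free_proj c11 1 (ftau x) = ftau (free_proj c00 0 x).
Proof.
by apply: sem_inj => K; rewrite sem_proj !sem_tau sem_proj; exact: os_tau.
Qed.

Definition free_one_stretching : one_stretching :=
  @OneStretching free_stretching free_one_magma free_one_trans
    (@free_proj_arrow edgeF) (@free_proj_arrow edgeG)
    (@free_proj_arrow edgeH) (@free_proj_arrow edgeK) free_proj_tau.

(** * The universal property *)

Lemma value_gen (K : cone) i n (x : X i n) : has_value (Gen x) (leg K i n x).
Proof. by []. Qed.

Definition gen i n (x : X i n) : free_magma false i n :=
  realize (fun K => value_gen K x).

Lemma sem_gen K i n (x : X i n) : sem K (gen x) = leg K i n x.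
Proof. exact: sem_realize. Qed.

Definition free_unit i : cset_hom (X i) (free_magma false i).
Proof.
apply: (@CSetHom _ _ (@gen i)) => r n j x; apply: sem_inj => K.
by rewrite sem_face !sem_gen cfun_face.
Defined.

Section Extension.
Variable K : cone.

Definition sem_cset b i : cset_hom (free_magma b i) (mag K b i) :=
  @CSetHom (free_magma b i) (mag K b i) (@sem K b i) (@sem_face K b i).

Lemma sem_circ_hom b i n (j : 'I_n.+1) (x y : free_magma b i n.+1) h h' :
  sem_cset b i _ (circ j x y h)
  = circ j (sem_cset b i _ x) (sem_cset b i _ y) h'.
Proof.
have [e E] := sem_circ K h erefl erefl.
by rewrite (Prop_irrelevance h' e); exact: E.
Qed.

Definition sem_hom b i : magma_hom (free_magma b i) (mag K b i) :=
  @MagmaHom (free_magma b i) (mag K b i) (sem_cset b i)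
    (@sem_degen K b i) (@sem_conn K b i) (@sem_circ_hom b i).

Definition free_ext_str i :
  stretching_hom (free_stretching i) (os_str K i).
Proof.
apply: (@StretchingHom (free_stretching i) (os_str K i)
  (sem_hom false i) (sem_hom true i)).
- by move=> n x; rewrite [RHS]sem_proj.
- move=> n j x y h h'; have [e E] := sem_br K j h erefl erefl.
  by rewrite (Prop_irrelevance h' e); exact: E.
- move=> g n j x y h h'; have [e E] := sem_cbr K h erefl erefl.
  by rewrite (Prop_irrelevance h' e); exact: E.
Defined.

Lemma free_ext_M :
  is_one_magma_hom free_one_magma (os_M K) (fun i => sh_m (free_ext_str i)).
Proof.
split=> [n x|n x|n x|n x|x]; [exact: (@sem_arr K false edgeF)
  | exact: (@sem_arr K false edgeG) | exact: (@sem_arr K false edgeH)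
  | exact: (@sem_arr K false edgeK) | exact: (@sem_tau K false)].
Qed.

Lemma free_ext_C :
  is_one_trans_hom free_one_trans (os_C K) (fun i => sh_c (free_ext_str i)).
Proof.
split=> [n x|n x|n x|n x|x]; [exact: (@sem_arr K true edgeF)
  | exact: (@sem_arr K true edgeG) | exact: (@sem_arr K true edgeH)
  | exact: (@sem_arr K true edgeK) | exact: (@sem_tau K true)].
Qed.

Definition free_ext : one_stretching_hom free_one_stretching K :=
  @OneStretchingHom free_one_stretching K free_ext_str free_ext_M free_ext_C.

(** For a variable layer b, the type of cells of the free one-stretching only
   becomes [free_cell b] after a case analysis on b. *)
Definition free_layer_cell b i n :
    mag free_one_stretching b i n -> free_cell b i n :=
  if b return mag free_one_stretching b i n -> free_cell b i n
  then id else id.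

Lemma free_layer_cell_inj b i n : injective (@free_layer_cell b i n).
Proof. by case: b. Qed.

Lemma layer_free_ext b i n (x : mag free_one_stretching b i n) :
  layer_hom free_ext b i n x = sem K (free_layer_cell x).
Proof. by case: b x. Qed.

End Extension.

Definition free_cone : cone := @Cone free_one_stretching free_unit.

(** Evaluation in the free one-stretching is tautological.  A term representing
    x has some value v there; each [free_ext K] sends v to the value of that
    term in K, which is also the value of x in K, so v = x. *)
Lemma value_free_cone b i n (x : mag free_one_stretching b i n) :
  has_value (K := free_cone) (repr (free_layer_cell x)) x.
Proof.
have [v tv] := repr_defined (free_layer_cell x) free_cone.
suff e : v = x by rewrite e in tv.
apply: free_layer_cell_inj; apply: sem_inj => K.
rewrite -layer_free_ext; apply: value_unique (value_repr K _).
by apply: (value_hom (K := free_cone)) tv => k m y; exact: sem_gen.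
Qed.

(** A morphism g under X must send x, the value of a representing term, to the
    value of this term in the target. *)
Lemma free_hom_sem (K : cone) (g : one_stretching_hom free_one_stretching K) :
  (forall i n (x : X i n),
     layer_hom g false i n (free_unit i n x) = leg K i n x) ->
  forall b i n (x : mag free_one_stretching b i n),
    layer_hom g b i n x = sem K (free_layer_cell x).
Proof.
move=> gleg b i n x; apply: value_unique (value_repr K _).
exact: (value_hom (K := free_cone) gleg) (value_free_cone x).
Qed.

End Free.

Theorem mainTheorem6 :
  exists (L : functor csets4 one_stretchings) (A : adjunction L forgetful),
    is_monad (T := forgetful \of L) (adj_unit A) (adj_mult A).
Proof.
pose cone_of (X : csets4) (E : one_stretchings) (f : hom X (forgetful E)) :
  cone X := @Cone X E f.
unshelve epose proof (@free_adjunction csets4 one_stretchings forgetful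
  free_one_stretching (fun X => @free_unit X)
  (fun X E f => free_ext (cone_of X E f)) _ _) as A.
- move=> X E f; apply: functional_extensionality_dep => i.
  by apply: cset_hom_eq => n x; exact: (sem_gen (cone_of X E f)).
- move=> X E g; apply: one_stretching_hom_eq => i.
  by apply: stretching_hom_eq => n x; symmetry;
    [apply: (free_hom_sem (K := cone_of _ _ _) (g := g) _ (b := false))
    |apply: (free_hom_sem (K := cone_of _ _ _) (g := g) _ (b := true))].
by exists _, A; exact: adjunction_monad.
Qed.
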